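(* Let $I$ and $\Gamma$ be arbitrary sets with $I$ uncountable, let $w:\Gamma\to(0,\infty)$ be any weight function, and let $1<p<\infty$, $p\neq 2$. Then $\ell^{p,\infty}(\Gamma,w)$ does not contain a subspace isomorphic to $\ell^2(I)$. Consequently, for $p\neq2$, $L^{p,\infty}(\{-1,1\}^I)$ is not isomorphic to a subspace of $L^{p,\infty}(\Omega,\Sigma,\mu)$ for any purely atomic measure space $(\Omega,\Sigma,\mu)$.
   Context: $\ell^{p,\infty}(\Gamma,w)$ denotes $L^{p,\infty}(\Gamma,\mathcal P(\Gamma),\mu)$ where $\mu(\sigma)=\sum_{\gamma\in\sigma}w(\gamma)$. For a measure space $(\Omega,\Sigma,\mu)$, $L^{p,\infty}(\Omega,\Sigma,\mu)$ is the space of (equivalence classes of) measurable $f$ with $\|f\|=\sup_{c>0}c\,(\mu\{|f|>c\})^{1/p}<\infty$, a Banach space under an equivalent norm; isomorphism means linear homeomorphism. $\{-1,1\}^I$ is the product of $I$ copies of the two-point probability space $\{-1,1\}$ with masses $\frac12$. An atom is a measurable $\sigma$ with $\mu(\sigma)>0$ such that each measurable $\sigma'\subseteq\sigma$ has $\mu(\sigma')=0$ or $\mu(\sigma\setminus\sigma')=0$; purely atomic means $\Sigma$ is the smallest $\sigma$-algebra containing all atoms and null sets. Measure spaces are assumed to contain a set of finite non-zero measure. *)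

(* Defs.v *)
From HB Require Import structures.
From mathcomp Require Import all_boot all_order all_algebra.
From mathcomp Require Import all_classical all_reals all_analysis.
From Stdlib Require Import List.
Set Implicit Arguments. Unset Strict Implicit. Unset Printing Implicit Defensive.
Import Order.TTheory GRing.Theory Num.Theory.
Local Open Scope classical_set_scope.
Local Open Scope ring_scope.

Definition weak_qnorm {R : realType} {T : Type} (mu : set T -> \bar R) (p : R)
    (f : T -> R) : \bar R :=
  ereal_sup [set ((c%:E * (poweR (mu [set x | (c < `|f x|)%R]) p^-1))%E) |
             c in [set c : R | 0 < c]].

Definition wmeasure {R : realType} {G : choiceType} (w : G -> R) (A : set G) : \bar R :=
  (\esum_(g in A) (w g)%:E)%E.

Definition l2norm {R : realType} {I : choiceType} (x : I -> R) : \bar R :=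
  poweR (\esum_(i in [set: I]) ((x i) ^+ 2)%:E)%E 2^-1.

(* Cylinder generators on {-1,1}^I, coded as I -> bool (true ~ 1, false ~ -1). *)
Definition coin_cyl (I : Type) : set (set (I -> bool)) :=
  [set A | exists (i : I) (b : bool), A = [set f | f i = b]].

Definition cube (I : Type) := g_sigma_algebraType (@coin_cyl I).

Definition is_coin_product {R : realType} (I : Type)
    (mu : set (cube I) -> \bar R) : Prop :=
  forall (s : list I) (e : I -> bool), NoDup s ->
    mu [set f : cube I | forall i, In i s -> f i = e i] = ((2%:R ^- (length s) : R)%:E).

Definition is_atom {R : realType} {d} {T : measurableType d}
    (mu : set T -> \bar R) (A : set T) : Prop :=
  measurable A /\ (0 < mu A)%E /\
  forall B, measurable B -> B `<=` A -> mu B = 0%E \/ mu (A `\` B) = 0%E.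

Definition purely_atomic {R : realType} {d} {T : measurableType d}
    (mu : set T -> \bar R) : Prop :=
  (measurable : set (set T)) =
  <<s [set A | is_atom mu A \/ (measurable A /\ mu A = 0%E)] >>.

(* Standing assumption: the measure space contains a set of finite non-zero measure. *)
Definition has_finite_pos_set {R : realType} {d} {T : measurableType d}
    (mu : set T -> \bar R) : Prop :=
  exists A, measurable A /\ (0 < mu A)%E /\ (mu A < +oo)%E.

Definition in_weakLp {R : realType} {d} {T : measurableType d}
    (mu : set T -> \bar R) (p : R) (f : T -> R) : Prop :=
  measurable_fun [set: T] f /\ (weak_qnorm mu p f < +oo)%E.

(* Main.v *)
Require Import Defs.
From Stdlib Require Import List.
From HB Require Import structures.
From mathcomp Require Import all_boot all_order all_algebra.
From mathcomp Require Import finmap.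
From mathcomp Require Import all_classical all_reals all_analysis.
From mathcomp Require Import measurable_realfun ring lra.
Import Order.TTheory GRing.Theory Num.Theory.
Local Open Scope classical_set_scope.
Local Open Scope ring_scope.
Set Implicit Arguments.
Unset Strict Implicit.

(* If [g i] are images of an [l2] basis, or of the Rademacher functions, under an
   isomorphic embedding, then the norm of a sum of [n] of them is [o(n)]. On an
   atom a measurable function exceeding [e] on a non-null set exceeds [e] almost
   everywhere, so only finitely many [g i] can exceed [e] there; hence each atom
   meets countably many [g i], and each [g i] lives on countably many atoms. An
   uncountable family therefore contains, for every [n], [n] essentially disjoint
   members, and their sum has weak quasi-norm of order [n `^ p^-1] (the upper bound
   is general, the lower one uses that uncountably many [g i] are large at a common
   level). This contradicts the order [n `^ 2^-1] unless [p = 2]. *)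

(** * The weak quasi-norm through the distribution function *)

Lemma gauge_le (R : realType) (m : \bar R) (p c K : R) :
  0 < p -> 0 < c -> 0 <= K -> (0 <= m)%E ->
  ((c%:E * poweR m p^-1 <= K%:E) = (m <= ((K / c) `^ p)%:E))%E.
Proof.
move=> p0 c0 K0; case: m => [r| |]//.
- rewrite lee_fin => r0.
  rewrite poweR_EFin -EFinM !lee_fin mulrC -ler_pdivlMr//.
  have pn0 : p != 0 by rewrite gt_eqF.
  have K1 : 0 <= K / c by rewrite divr_ge0// ltW.
  apply/idP/idP => [H|H].
  + rewrite -[r]powRr1// -(mulVf pn0) powRrM.
    by apply: ge0_ler_powR; rewrite ?nnegrE ?powR_ge0// ltW.
  + rewrite -[leRHS]powRr1// -(divff pn0) powRrM.
    by apply: ge0_ler_powR; rewrite ?nnegrE ?powR_ge0 ?invr_ge0// ltW.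
- by move=> _; rewrite poweRyr ?invr_neq0 ?gt_eqF// gt0_muley ?lte_fin.
Qed.

Lemma weak_qnorm_le (R : realType) d (T : measurableType d)
    (mu : {measure set T -> \bar R}) (p K : R) (f : T -> R) :
  0 < p -> 0 <= K ->
  (weak_qnorm mu p f <= K%:E)%E <->
  (forall c, 0 < c -> (mu [set x | (c < `|f x|)%R] <= ((K / c) `^ p)%:E)%E).
Proof.
move=> p0 K0; split => [H c c0|H].
- rewrite -gauge_le//; apply: le_trans H; apply: ereal_sup_ubound.
  by exists c.
- apply: ge_ereal_sup => _ [c /= c0 <-].
  by rewrite gauge_le//; exact: H.
Qed.

Lemma measurable_norm_gt (R : realType) d (T : measurableType d) (f : T -> R)
    (c : R) :
  measurable_fun setT f -> measurable [set x | c < `|f x|].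
Proof.
move=> mf; rewrite (_ : [set _ | _] = (Num.norm \o f) @^-1` `]c, +oo[).
  by rewrite -[X in measurable X]setTI; apply: measurableT_comp.
by apply/seteqP; split => x /=; rewrite in_itv/= andbT.
Qed.

Lemma measurable_neq0 (R : realType) d (T : measurableType d) (f : T -> R) :
  measurable_fun setT f -> measurable [set x | f x != 0].
Proof.
move=> mf; rewrite (_ : [set _ | _] = [set x | 0 < `|f x|]).
  exact: measurable_norm_gt.
by apply/seteqP; split => x /=; rewrite normr_gt0.
Qed.

(* The two constants leave room for a rational level. *)
Lemma weak_qnorm_gt (R : realType) d (T : measurableType d)
    (mu : {measure set T -> \bar R}) (p k K : R) (f : T -> R) :
  0 < p -> 0 <= k -> k < K -> measurable_fun setT f ->
  (K%:E < weak_qnorm mu p f)%E ->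
  exists2 q : rat, 0 < ratr q :> R &
    (((k / ratr q) `^ p)%:E < mu [set x | (ratr q < `|f x|)%R])%E.
Proof.
move=> p0 k0 kK mf; have K0 : 0 < K by exact: le_lt_trans kK.
have K0' := ltW K0.
rewrite ltNge => /negP/(contra_not (weak_qnorm_le mu f p0 (ltW K0)).2) /existsNP[c].
move=> /not_implyP[c0 /negP]; rewrite -ltNge => H; have c0' := ltW c0.
(* The bound [K] fails at some real level [c]. A rational [q] between [c * (k / K)] and [c] has a
   larger level set, and [k / q] is still below [K / c]. *)
have : c * (k / K) < c by rewrite gtr_pMr// ltr_pdivrMr// mul1r.
move=> /rat_in_itvoo[q]; rewrite in_itv/= => /andP[q1 q2].
have q0 : 0 < ratr q :> R.
  by apply: le_lt_trans q1; rewrite mulr_ge0// divr_ge0.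
exists q => //; move: (ratr q) q0 q1 q2 => r q0 q1 q2; have q0' := ltW q0.
apply: (@le_lt_trans _ _ ((K / c) `^ p)%:E).
  rewrite lee_fin ge0_ler_powR ?nnegrE ?divr_ge0 ?(ltW p0)//.
  rewrite ler_pdivrMr// mulrAC ler_pdivlMr// mulrC [leRHS]mulrC.
  by rewrite -ler_pdivrMr// -mulrA ltW.
apply: (lt_le_trans H); apply: le_measure; rewrite ?inE.
- exact: measurable_norm_gt.
- exact: measurable_norm_gt.
- by move=> x /= ; exact: lt_trans.
Qed.

(** * Essentially disjoint functions *)

Lemma measure_eq_off_null (R : realType) d (T : measurableType d)
    (mu : {measure set T -> \bar R}) (A B N : set T) :
  measurable A -> measurable B -> measurable N -> mu N = 0%E ->
  A `|` N = B `|` N -> mu A = mu B.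
Proof.
by move=> mA mB mN N0 e; rewrite -(measureU0 mA mN N0) e (measureU0 mB mN N0).
Qed.

(** Off the null set [N] where both functions are non-zero at most one summand survives, and since
    [0 <= c] a point of a level set lies in the support. So the level sets are disjoint once [N] is
    removed, and removing it changes no measure. *)
Lemma measure_norm_gt_add (R : realType) d (T : measurableType d)
    (mu : {measure set T -> \bar R}) (f g : T -> R) (c : R) :
  measurable_fun setT f -> measurable_fun setT g -> 0 <= c ->
  mu ([set x | f x != 0] `&` [set x | g x != 0]) = 0%E ->
  mu [set x | c < `|f x + g x|] =
  (mu [set x | (c < `|f x|)%R] + mu [set x | (c < `|g x|)%R])%E.
Proof.
move=> mf mg c0; set N := _ `&` _ => N0.
have mN : measurable N by apply: measurableI; exact: measurable_neq0.
have mA := measurable_norm_gt c mf; have mB := measurable_norm_gt c mg.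
have mC := measurable_norm_gt c (measurable_funD mf mg).
have DN X : X `\` N `|` N = X `|` N by rewrite setDE setUIl setUCl setIT.
set A := [set x | c < `|f x|] in mA *; set B := [set x | c < `|g x|] in mB *.
rewrite -(measure_eq_off_null (A := A `\` N) (B := A) _ _ mN N0); last 3 first.
- exact: measurableD.
- exact: mA.
- exact: DN.
rewrite -(measure_eq_off_null (A := B `\` N) (B := B) _ _ mN N0); last 3 first.
- exact: measurableD.
- exact: mB.
- exact: DN.
have nz h (x : T) : c < `|h x| -> h x != 0 :> R.
  by move=> H; rewrite -normr_gt0; apply: le_lt_trans H.
rewrite -measureU; [|exact: measurableD|exact: measurableD|]; last first.
  apply/seteqP; split => // x [[/nz fx nN] [/nz gx _]].
  by apply: nN; split.
apply: (measure_eq_off_null _ _ mN N0) => //.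
  by apply: measurableU; exact: measurableD.
apply/seteqP; split => x; case: (pselect (N x)) => [|nN]; try by right.
- move=> [/= H|//]; left.
  have [f0|f0] := eqVneq (f x) 0.
    by right; split=> //=; move: H; rewrite f0 add0r.
  left; split=> //=; move: H; have [->|g0] := eqVneq (g x) 0; first by rewrite addr0.
  by exfalso; apply: nN; split.
- move=> [[[/= H _]|[/= H _]]|//]; left => /=.
  + have [->|g0] := eqVneq (g x) 0; first by rewrite addr0.
    by exfalso; apply: nN; split=> //; exact: nz H.
  + have [->|f0] := eqVneq (f x) 0; first by rewrite add0r.
    by exfalso; apply: nN; split=> //; exact: nz H.
Qed.

(** Boolean-valued, so as to serve as a relation in [all] and [pairwise]. *)
Definition ess_disjoint (R : realType) d (T : measurableType d)
    (mu : set T -> \bar R) (f g : T -> R) : bool :=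
  mu ([set x | f x != 0] `&` [set x | g x != 0]) == 0%E.

Lemma ess_disjoint_sum (R : realType) d (T : measurableType d)
    (mu : {measure set T -> \bar R}) (I : Type) (f : T -> R) (g : I -> T -> R)
    (s : seq I) :
  measurable_fun setT f -> (forall i, measurable_fun setT (g i)) ->
  all (fun i => ess_disjoint mu f (g i)) s ->
  ess_disjoint mu f (fun x => \sum_(i <- s) g i x).
Proof.
move=> mf mg; elim: s => [|i s IH].
  move=> _; rewrite /ess_disjoint (_ : _ `&` _ = set0) ?measure0//.
  by apply/seteqP; split => // x [_] /=; rewrite big_nil eqxx.
move=> /= /andP[/eqP fi /IH/eqP fs].
have ms : measurable_fun setT (fun x => \sum_(i <- s) g i x).
  by apply: measurable_sum.
rewrite /ess_disjoint -measure_le0 -(adde0 0%E) -{1}fi -fs.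
apply: le_trans (measureU2 _ _ _); last 2 first.
- by apply: measurableI; exact: measurable_neq0.
- by apply: measurableI; exact: measurable_neq0.
apply: le_measure; rewrite ?inE.
- apply: measurableI; first exact: measurable_neq0.
  by apply: measurable_neq0; apply: measurable_sum.
- by apply: measurableU; apply: measurableI; exact: measurable_neq0.
- move=> x [/= fx]; rewrite big_cons; have [->|] := eqVneq (g i x) 0; last by left.
  by rewrite add0r; right.
Qed.

Lemma measure_norm_gt_sum (R : realType) d (T : measurableType d)
    (mu : {measure set T -> \bar R}) (I : Type) (g : I -> T -> R) (s : seq I)
    (c : R) :
  (forall i, measurable_fun setT (g i)) -> 0 <= c ->
  pairwise (fun i j => ess_disjoint mu (g i) (g j)) s ->
  mu [set x | c < `|\sum_(i <- s) g i x|] =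
  (\sum_(i <- s) mu [set x | (c < `|g i x|)%R])%E.
Proof.
move=> mg c0; elim: s => [_|i s IH].
  rewrite big_nil (_ : [set _ | _] = set0) ?measure0//.
  by apply/seteqP; split => // x /=; rewrite big_nil normr0 ltNge c0.
move=> /= /andP[ds /IH e]; rewrite big_cons -e -measure_norm_gt_add//.
- by congr (mu _); apply/seteqP; split => x /=; rewrite big_cons.
- exact: measurable_sum.
- by apply/eqP; apply: ess_disjoint_sum.
Qed.

(** * Selection from uncountable families *)

Lemma countable_setU (T : Type) (A B : set T) :
  countable A -> countable B -> countable (A `|` B).
Proof.
move=> cA cB; rewrite -bigcup2E; apply: bigcup_countable => //.
by move=> [|[|i]] _ /=.
Qed.

Lemma powR_unbounded (R : realType) (s M : R) : 0 < s ->
  exists n : nat, M < n.+1%:R `^ s.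
Proof.
move=> s0; set N := `|M| `^ s^-1.
have N0 : 0 <= N by exact: powR_ge0.
have h : `|M| = N `^ s by rewrite /N -powRrM mulVf ?gt_eqF// powRr1.
exists (Num.bound N); apply: le_lt_trans (ler_norm _) _; rewrite h.
apply: gt0_ltr_powR => //; rewrite ?nnegrE//.
apply: lt_trans (archi_boundP N0) _; by rewrite ltr_nat.
Qed.

(** A greedy choice: the elements already chosen, together with everything unrelated to one of them,
    form a countable set, which cannot exhaust [D]. *)
Lemma uncountable_pairwise (I : choiceType) (D : set I) (r : rel I) n :
  ~ countable D -> symmetric r ->
  (forall i, D i -> countable [set j | ~~ r i j]) ->
  exists s : seq I, [/\ size s = n, uniq s, pairwise r s & forall i, i \in s -> D i].
Proof.
move=> cD rC Dr; elim: n => [|n [s [sn us rs sD]]]; first by exists [::].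
pose E := [set` s] `|` \bigcup_(i in [set` s]) [set j | ~~ r i j].
have cE : countable E.
  rewrite /E; apply: countable_setU; first exact: finite_set_countable.
  apply: bigcup_countable; first exact: finite_set_countable.
  by move=> i /= /sD; exact: Dr.
have /existsNP[x /not_implyP[Dx nE]] : ~ (D `<=` E).
  by move=> /subset_card_le DE; apply: cD; exact: sub_countable cE.
exists (x :: s); split => //=; first by rewrite sn.
- by rewrite us andbT; apply/negP => xs; apply: nE; left.
- rewrite rs andbT; apply/allP => y ys; rewrite rC; apply/negPn/negP => h.
  by apply: nE; right; exists y.
- by move=> i; rewrite inE => /predU1P[->//|]; exact: sD.
Qed.

(** * Atoms and the functions that meet them *)

(** Zorn gives a maximal disjoint family [E] of atoms inside [B]. It is countable because [mu B] is
    finite, and a non-null remainder would contain one more atom, against maximality. *)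
Lemma atoms_exhaust (R : realType) d (T : measurableType d)
    (mu : {measure set T -> \bar R}) (B : set T) :
  (forall A, measurable A -> (0 < mu A)%E ->
     exists2 A', A' `<=` A & is_atom mu A') ->
  measurable B -> (mu B < +oo)%E ->
  exists2 F : (set T)^nat, (forall k, is_atom mu (F k) \/ F k = set0) &
    mu (B `\` \bigcup_k F k) = 0%E.
Proof.
move=> hatom mB Bfin.
have [E [ED tE maxE]] :=
  ex_maximal_disjoint_subcollection id [set A | is_atom mu A /\ A `<=` B].
have mE A : E A -> measurable A by move=> /ED[[]].
pose S k := [set A | E A /\ (k.+1%:R^-1%:E < mu A)%E].
have ES : E = \bigcup_k S k.
    apply/seteqP; split => [A EA|A [k _ []]//].
    have [[_ [A0 _]] AB] := ED _ EA.
    have Afin : (mu A < +oo)%E.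
      by apply: le_lt_trans Bfin; apply: le_measure; rewrite ?inE//; exact: mE.
    have Afin' : mu A \is a fin_num by rewrite ge0_fin_numE// ltW.
    have fA0 : 0 < fine (mu A) by rewrite fine_gt0// A0.
    have [k] := ltr_add_invr fA0.
    rewrite add0r => hk; exists k => //; split => //.
    by rewrite -[mu A]fineK// lte_fin.
have fS k : finite_set (S k).
  (* More than [mu B * k.+1] disjoint subsets of [B], each of measure above [k.+1%:R^-1], would
     together outweigh [B]. *)
  apply: contrapT => /infinite_set_fset.
  move=> /(_ (Num.bound (fine (mu B) * k.+1%:R)))[F FS sF].
  have : (\sum_(A \in [set` F]) mu A <= mu B)%E.
    rewrite -(measure_fin_bigcup mu (F := id))//.
    - apply: le_measure; rewrite ?inE//.
      + by apply: fin_bigcup_measurable => // A /FS[/mE].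
      + by apply: bigcup_sub => A /FS[/ED[]].
    - by apply: sub_trivIset tE => A /FS[].
    - by move=> A /FS[/mE].
  apply/negP; rewrite -ltNge fsbig_finite//= set_fsetK.
  apply: (@lt_le_trans _ _ (\sum_(A <- F) k.+1%:R^-1%:E)%E); last first.
    by rewrite big_seq [leRHS]big_seq; apply: lee_sum => A AF; apply: ltW; have [] := FS _ AF.
  have Bfin' : mu B \is a fin_num by rewrite ge0_fin_numE.
  rewrite sumEFin big_const_seq count_predT iter_addr addr0 -[mu B]fineK//.
  rewrite lte_fin -[ltRHS]mulr_natl ltr_pdivlMr//.
  apply: lt_le_trans (archi_boundP _) _; last by rewrite ler_nat.
  by rewrite mulr_ge0// fine_ge0.
have cE : countable E.
  by rewrite ES; apply: bigcup_countable => // k _; exact: finite_set_countable.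
have mU : measurable (\bigcup_(A in E) A).
  rewrite ES bigcup_bigcup; apply: bigcupT_measurable => k.
  by apply: fin_bigcup_measurable => // A [/mE].
have [F hF FE] : exists2 F : (set T)^nat,
    (forall k, is_atom mu (F k) \/ F k = set0) &
    \bigcup_k F k = \bigcup_(A in E) A.
  (* An empty [E] has no enumeration by its members, whence the alternative [F k = set0]. *)
  case/pfcard_geP: cE => [E0|[f]].
    exists (fun=> set0); first by right.
    by rewrite E0 bigcup_set0 bigcup0.
  have fE k : E (f k) by exact: funS.
  exists f; first by move=> k; left; have [] := ED _ (fE k).
  apply/seteqP; split => x [k]; first by exists (f k).
  by move=> /(@surj _ _ _ _ f)[m _ <-] fx; exists m.
exists F => //; rewrite FE.
apply/eqP; rewrite -measure_le0 leNgt; apply/negP => pos.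
have [A' A'B atA'] := hatom _ (measurableD mB mU) pos.
(* Only a non-empty [A'] lying outside the union of [E] is sure to be a new member. *)
have A'n : A' !=set0.
  apply/set0P/eqP => e; case: atA' => _ [+ _]; by rewrite e measure0 ltxx.
have nE : ~ E A'.
  by move=> EA; case: A'n => x A'x; have [_] := A'B _ A'x; apply; exists A'.
apply: (maxE (A' |` E)).
- split; first by move=> A; right.
  by move=> /(_ A' (or_introl erefl)).
- move=> A [->|/ED//]; split => //; exact: subset_trans A'B _.
- move=> A C [->|EA] [->|EC]//.
  + by move=> [x [/A'B[_ h] Cx]]; exfalso; apply: h; exists C.
  + by move=> [x [Ax /A'B[_ h]]]; exfalso; apply: h; exists A.
  + exact: tE.
Qed.

Lemma null_neq0 (R : realType) d (T : measurableType d)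
    (mu : {measure set T -> \bar R}) (A : set T) (f : T -> R) :
  measurable A -> measurable_fun setT f ->
  (forall k, mu (A `&` [set x | (k.+1%:R^-1 < `|f x|)%R]) = 0%E) ->
  mu (A `&` [set x | f x != 0]) = 0%E.
Proof.
move=> mA mf h; have mX := measurableI _ _ mA (measurable_neq0 mf).
apply/(negligibleP mu mX).
apply: (@negligibleS _ _ _ _
  (\bigcup_k (A `&` [set x | (k.+1%:R^-1 < `|f x|)%R]))).
  move=> x [Ax /=]; rewrite -normr_gt0 => /ltr_add_invr[k].
  by rewrite add0r => hk; exists k.
apply: negligible_bigcup => k.
have mk := measurableI _ _ mA (measurable_norm_gt k.+1%:R^-1 mf).
by apply/(negligibleP mu mk); exact: h.
Qed.

Lemma atom_finite (R : realType) d (T : measurableType d)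
    (mu : {measure set T -> \bar R}) (I : choiceType) (g : I -> T -> R)
    (p K a e : R) (A : set T) :
  0 < p -> 0 <= K -> a < 1 -> 0 < e ->
  (forall i, measurable_fun setT (g i)) ->
  (forall s : seq I, uniq s ->
     (weak_qnorm mu p (fun x => \sum_(i <- s) g i x)%R <=
        (K * (size s)%:R `^ a)%:E)%E) ->
  is_atom mu A ->
  finite_set [set i | mu (A `&` [set x | (e < g i x)%R]) <> 0%E].
Proof.
move=> p0 K0 a1 e0 mg U [mA [A0 atA]]; set J := [set i | _].
have mgt i (c : R) : measurable [set x | c < g i x].
  rewrite (_ : [set _ | _] = g i @^-1` `]c, +oo[).
    by rewrite -[X in measurable X]setTI; apply: mg.
  by apply/seteqP; split => x /=; rewrite in_itv/= andbT.
have mge (s : seq I) (c : R) : measurable [set x | c <= \sum_(i <- s) g i x].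
  rewrite (_ : [set _ | _] = (fun x => \sum_(i <- s) g i x) @^-1` `[c, +oo[).
    by rewrite -[X in measurable X]setTI; apply: measurable_sum.
  by apply/seteqP; split => x /=; rewrite in_itv/= andbT.
have null s : {subset s <= [pred i | i \in J]} ->
    mu (A `\` [set x | (size s)%:R * e <= \sum_(i <- s) g i x]) = 0%E.
  elim: s => [_|i s IH sJ].
    rewrite (_ : _ `\` _ = set0) ?measure0//.
    by apply/seteqP; split => // x [_] /=; rewrite mul0r big_nil lexx.
  have Ji : J i by apply/set_mem; apply: sJ; rewrite mem_head.
  have gi : mu (A `\` [set x | e < g i x]) = 0%E.
    case: (atA (A `&` [set x | e < g i x])).
    - exact: measurableI.
    - by move=> x [].
    - by move=> h; case: Ji.
    - by rewrite setDIr setDv set0U.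
  have gs := IH (fun j js => sJ j (mem_behead (s := i :: s) js)).
  apply/eqP; rewrite -measure_le0 -(adde0 0%E) -{1}gi -gs.
  have m1 := measurableD mA (mgt i e).
  have m2 := measurableD mA (mge s ((size s)%:R * e)).
  apply: le_trans (measureU2 mu m1 m2).
  apply: le_measure; rewrite ?inE; [exact: measurableD|exact: measurableU|].
  move=> x [Ax /= h]; have [gx|gx] := ltP e (g i x); last first.
    by left; split=> //=; apply/negP; rewrite -leNgt.
  right; split => //= h'; apply: h; rewrite big_cons -natr1 mulrDl mul1r addrC.
  by rewrite lerD// ltW.
(* [mu A] may be infinite, so a positive real below it takes its place. *)
have [m m0 mm] : exists2 m : R, 0 < m & (m%:E <= mu A)%E.
  case: (mu A) A0 => [r| |]//; first by rewrite lte_fin => r0; exists r.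
  by move=> _; exists 1 => //; rewrite leey.
apply: contrapT => /infinite_set_fset Jinf.
have a1' : 0 < 1 - a by rewrite subr_gt0.
have [n nM] := powR_unbounded (2 * K / e / m `^ p^-1) a1'.
have [F FJ sF] := Jinf n.+1.
pose s := take n.+1 F.
have ss : size s = n.+1 by rewrite size_takel.
have us : uniq s by rewrite take_uniq.
have sJ : {subset s <= [pred i | i \in J]}.
  by move=> i /mem_take iF; apply/mem_set; exact: FJ.
(* Level sets are strict while the sum is only known to be at least [n.+1%:R * e]; halving gives a
   strict inequality and accounts for the [2] in the choice of [n]. *)
pose c := n.+1%:R * e / 2.
have c0 : 0 < c by rewrite divr_gt0// mulr_gt0.
have := (weak_qnorm_le mu _ p0 (mulr_ge0 K0 (powR_ge0 _ a))).1 (U s us) _ c0.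
rewrite ss; apply/negP; rewrite -ltNge.
apply: (@lt_le_trans _ _ (mu A)); last first.
  have m1 := measurable_norm_gt c (measurable_sum s mg).
  have m2 := measurableD mA (mge s (n.+1%:R * e)).
  rewrite -[leRHS]adde0 -(null _ sJ) ss.
  apply: le_trans (measureU2 mu m1 m2).
  apply: le_measure; rewrite ?inE//; first exact: measurableU.
  move=> x Ax; have [h|h] := leP (n.+1%:R * e) (\sum_(i <- s) g i x).
    left => /=; apply: lt_le_trans (ler_norm _); apply: lt_le_trans h.
    by rewrite /c ltr_pdivrMr// ltr_pMr ?mulr_gt0// ltr1n.
  by right; split => //=; apply/negP; rewrite -ltNge.
apply: lt_le_trans mm; rewrite lte_fin.
have n0 : 0 < n.+1%:R :> R by [].
have -> : m = (m `^ p^-1) `^ p.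
  by rewrite -powRrM mulVf ?gt_eqF// powRr1 ?ltW.
apply: gt0_ltr_powR => //; rewrite ?nnegrE ?powR_ge0//.
  by rewrite divr_ge0 ?(ltW c0)// mulr_ge0// powR_ge0.
rewrite ltr_pdivrMr// /c.
have mp : 0 < m `^ p^-1 by exact: powR_gt0.
have na : 0 < n.+1%:R `^ a :> R by exact: powR_gt0.
move: nM; rewrite powRB ?pnatr_eq0 ?implybT// powRr1// ltr_pdivlMr// => nM.
have : 2 * K * n.+1%:R `^ a < n.+1%:R * (m `^ p^-1 * e).
  have -> : 2 * K * n.+1%:R `^ a =
      2 * K / e / m `^ p^-1 * n.+1%:R `^ a * (m `^ p^-1 * e).
    by field; rewrite !gt_eqF.
  by rewrite ltr_pM2r// mulr_gt0.
by move=> h; lra.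
Qed.

Lemma weak_qnormN (R : realType) (T : Type) (mu : set T -> \bar R) (p : R)
    (f : T -> R) :
  weak_qnorm mu p (fun x => - f x) = weak_qnorm mu p f.
Proof.
rewrite /weak_qnorm; congr ereal_sup; apply: eq_imagel => c _.
by congr (_ * poweR (mu _) _)%E; apply/seteqP; split => x /=; rewrite normrN.
Qed.

Lemma sum_cst_seq (R : realType) (I : Type) (s : seq I) (b : R) :
  (\sum_(i <- s) b%:E)%E = ((size s)%:R * b)%:E.
Proof. by rewrite sumEFin big_const_seq count_predT iter_addr_0 mulr_natl. Qed.

Lemma ess_disjointC (R : realType) d (T : measurableType d)
    (mu : set T -> \bar R) (f g : T -> R) :
  ess_disjoint mu f g = ess_disjoint mu g f.
Proof. by rewrite /ess_disjoint setIC. Qed.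

(** The support is the union of the level sets at [k.+1%:R^-1], and each of these splits by sign
    into two cases of [atom_finite]. *)
Lemma atom_countable (R : realType) d (T : measurableType d)
    (mu : {measure set T -> \bar R}) (I : choiceType) (g : I -> T -> R)
    (p K a : R) (A : set T) :
  0 < p -> 0 <= K -> a < 1 ->
  (forall i, measurable_fun setT (g i)) ->
  (forall s : seq I, uniq s ->
     (weak_qnorm mu p (fun x => \sum_(i <- s) g i x)%R <=
        (K * (size s)%:R `^ a)%:E)%E) ->
  is_atom mu A ->
  countable [set i | mu (A `&` [set x | g i x != 0]) <> 0%E].
Proof.
move=> p0 K0 a1 mg U atA; have [mA _] := atA.
pose J k := [set i | mu (A `&` [set x | (k.+1%:R^-1 < `|g i x|)%R]) <> 0%E].
suff cJ k : countable (J k).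
  have : countable (\bigcup_k J k) by exact: bigcup_countable.
  apply: sub_countable; apply: subset_card_le => i /=; apply: contra_notP => h.
  apply: null_neq0 => // k; apply: contrapT => hk.
  by apply: h; exists k.
apply: finite_set_countable.
have e0 : 0 < k.+1%:R^-1 :> R by [].
have fp := atom_finite p0 K0 a1 e0 mg U atA.
have mgN i : measurable_fun setT (fun x => - g i x) by exact: measurable_funN.
have UN s : uniq s -> (weak_qnorm mu p (fun x => \sum_(i <- s) - g i x)%R <=
    (K * (size s)%:R `^ a)%:E)%E.
  move=> us; rewrite (_ : (fun _ => _) = (fun x => - \sum_(i <- s) g i x)).
    by rewrite weak_qnormN; exact: U.
  by apply/funext => x; rewrite sumrN.
have fn := atom_finite p0 K0 a1 e0 mgN UN atA.
have : finite_set ([set i | mu (A `&` [set x | k.+1%:R^-1 < g i x]) <> 0%E] `|`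
   [set i | mu (A `&` [set x | k.+1%:R^-1 < - g i x]) <> 0%E]).
  by rewrite finite_setU.
apply: sub_finite_set => i /=; rewrite /J /=; apply: contra_notP.
move=> /not_orP[/contrapT h1 /contrapT h2].
have m1 : measurable (A `&` [set x | k.+1%:R^-1 < g i x]).
  apply: measurableI => //; rewrite (_ : [set _ | _] = g i @^-1` `]k.+1%:R^-1, +oo[).
    by rewrite -[X in measurable X]setTI; apply: mg.
  by apply/seteqP; split => x /=; rewrite in_itv/= andbT.
have m2 : measurable (A `&` [set x | k.+1%:R^-1 < - g i x]).
  apply: measurableI => //.
  rewrite (_ : [set _ | _] = (fun x => - g i x) @^-1` `]k.+1%:R^-1, +oo[).
    by rewrite -[X in measurable X]setTI; apply: mgN.
  by apply/seteqP; split => x /=; rewrite in_itv/= andbT.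
have m3 := measurableI _ _ mA (measurable_norm_gt k.+1%:R^-1 (mg i)).
apply/(negligibleP mu m3).
apply: negligibleS (negligibleU _ _); last 2 first.
- exact/(negligibleP mu m1).
- exact/(negligibleP mu m2).
by move=> x [Ax] /=; rewrite ltr_normr => /orP[h|h]; [left|right].
Qed.

(** The support of [g i] is the union of the sets [B k], of finite measure by the bound on [g i]
    alone. Each [B k] is covered up to a null set by countably many atoms, and each atom meets
    countably many [g j]. *)
Lemma neighbours_countable (R : realType) d (T : measurableType d)
    (mu : {measure set T -> \bar R}) (I : choiceType) (g : I -> T -> R)
    (p K a : R) (i : I) :
  (forall A, measurable A -> (0 < mu A)%E ->
     exists2 A', A' `<=` A & is_atom mu A') ->
  0 < p -> 0 <= K -> a < 1 ->
  (forall i, measurable_fun setT (g i)) ->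
  (forall s : seq I, uniq s ->
     (weak_qnorm mu p (fun x => \sum_(i <- s) g i x)%R <=
        (K * (size s)%:R `^ a)%:E)%E) ->
  countable [set j | ~~ ess_disjoint mu (g i) (g j)].
Proof.
move=> hatom p0 K0 a1 mg U.
pose B k := [set x | k.+1%:R^-1 < `|g i x|].
have mB k : measurable (B k) by exact: measurable_norm_gt.
have Bfin k : (mu (B k) < +oo)%E.
  have e0 : 0 < k.+1%:R^-1 :> R by [].
  have := U [:: i] isT.
  rewrite (_ : (fun _ => _) = g i); last by apply/funext => x; rewrite big_seq1.
  move=> /(weak_qnorm_le mu (g i) p0 (mulr_ge0 K0 (powR_ge0 _ a))).1.
  by move=> /(_ _ e0) h; apply: le_lt_trans h _; rewrite ltry.
pose J k := [set j | mu (B k `&` [set x | g j x != 0]) <> 0%E].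
suff cJ k : countable (J k).
  have : countable (\bigcup_k J k) by exact: bigcup_countable.
  apply: sub_countable; apply: subset_card_le => j /= /negP.
  apply: contra_notP => h; apply/eqP; rewrite setIC.
  apply: null_neq0 => // [|k]; first exact: measurable_neq0.
  by apply: contrapT => hk; apply: h; exists k => //; rewrite /J/= setIC.
have [F atF F0] := atoms_exhaust hatom (mB k) (Bfin k).
have mF m : measurable (F m) by case: (atF m) => [[]|->].
have : countable (\bigcup_m [set j | mu (F m `&` [set x | g j x != 0]) <> 0%E]).
  apply: bigcup_countable => // m _; case: (atF m) => [|->].
    by apply: atom_countable U.
  by rewrite (_ : [set _ | _] = set0)//; apply/seteqP; split => // j /=;
    rewrite set0I measure0.
apply: sub_countable; apply: subset_card_le => j; rewrite /J /=.
apply: contra_notP => h.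
have mN := measurable_neq0 (mg j).
have mBN := measurableI _ _ (mB k) mN.
have mE : measurable (\bigcup_m F m) by exact: bigcupT_measurable.
apply/(negligibleP mu mBN).
apply: (@negligibleS _ _ _ _
  ((B k `\` \bigcup_m F m) `|` \bigcup_m (F m `&` [set x | g j x != 0]))).
  move=> x [Bx gx]; have [[m _ Fx]|nE] := pselect ((\bigcup_m F m) x).
    by right; exists m.
  by left.
apply: negligibleU; first by apply/(negligibleP mu (measurableD (mB k) mE)).
apply: negligible_bigcup => m; apply/(negligibleP mu (measurableI _ _ (mF m) mN)).
by apply: contrapT => hm; apply: h; exists m.
Qed.

(** * Growth of disjoint sums against the exponent one half *)

(** The upper exponent [a] is left free so that a crude upper bound can be fed in. For [p < 2]
    disjoint sums grow too fast for the upper bound, as [a * p < 1]; for [2 < p] they grow too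
    slowly for the lower one. *)
Lemma no_l2_system (R : realType) d (T : measurableType d)
    (mu : {measure set T -> \bar R}) (I : choiceType) (g : I -> T -> R)
    (p c K a : R) :
  (forall A, measurable A -> (0 < mu A)%E ->
     exists2 A', A' `<=` A & is_atom mu A') ->
  ~ countable [set: I] ->
  0 < p -> p != 2 -> 0 < c -> 0 <= K -> a < 1 -> (p < 2 -> a * p < 1) ->
  (forall i, measurable_fun setT (g i)) ->
  (forall s : seq I, uniq s ->
     (weak_qnorm mu p (fun x => \sum_(i <- s) g i x)%R <=
        (K * (size s)%:R `^ a)%:E)%E) ->
  (forall s : seq I, uniq s ->
     ((c * (size s)%:R `^ 2^-1)%:E <=
        weak_qnorm mu p (fun x => \sum_(i <- s) g i x)%R)%E) ->
  False.
Proof.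
move=> hatom cI p0 p2 c0 K0 a1 ap mg U L.
have nb i := neighbours_countable i hatom p0 K0 a1 mg U.
have sym : symmetric (fun i j => ess_disjoint mu (g i) (g j)).
  by move=> i j; exact: ess_disjointC.
have U1 i : (weak_qnorm mu p (g i) <= K%:E)%E.
  have := U [:: i] isT; rewrite powR1 mulr1.
  by rewrite (_ : (fun _ => _) = g i)//; apply/funext => x; rewrite big_seq1.
have L1 i : (c%:E <= weak_qnorm mu p (g i))%E.
  have := L [:: i] isT; rewrite powR1 mulr1.
  by rewrite (_ : (fun _ => _) = g i)//; apply/funext => x; rewrite big_seq1.
have powp (x : R) : 0 <= x -> x = (x `^ p^-1) `^ p.
  by move=> x0; rewrite -powRrM mulVf ?gt_eqF// powRr1.
case: (ltgtP p 2) p2 => // p2 _.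
(* [c / 4 < c / 2 < c] supplies the two strict gaps that [weak_qnorm_gt] asks for. *)
- have [k k0 kc] : exists2 k, 0 < k & k < c / 2 by exists (c / 4); lra.
  pose D (q : rat) := [set i | 0 < ratr q :> R /\
    (((k / ratr q) `^ p)%:E < mu [set x | (ratr q < `|g i x|)%R])%E].
  (* Every index lies in some [D q] and there are countably many rationals, so uncountably many
     [g i] are large at one common level. *)
  have [q cD] : exists q, ~ countable (D q).
    apply/existsNP => cD; apply: cI.
    have : countable (\bigcup_(q in [set: rat]) D q) by exact: bigcup_countable.
    apply: sub_countable; apply: subset_card_le => i _.
    have [|q q0 hq] := weak_qnorm_gt p0 (ltW k0) kc (mg i) (mu := mu).
      by apply: lt_le_trans (L1 i); rewrite lte_fin; lra.
    by exists q.
  have ap1 : 0 < 1 - a * p by rewrite subr_gt0 ap.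
  have [n nM] := powR_unbounded ((K / k) `^ p) ap1.
  have [s [sn us ds sD]] := uncountable_pairwise n.+1 cD sym (fun i _ => nb i).
  have q0 : 0 < ratr q :> R.
    by case: s sn {us ds} sD => // i s _ /(_ i (mem_head _ _))[].
  have := (weak_qnorm_le mu _ p0 (mulr_ge0 K0 (powR_ge0 _ a))).1 (U s us) _ q0.
  rewrite (measure_norm_gt_sum mg (ltW q0) ds).
  apply/negP; rewrite -ltNge.
  apply: (@lt_le_trans _ _ (\sum_(i <- s) ((k / ratr q) `^ p)%:E)%E); last first.
    by rewrite big_seq [leRHS]big_seq; apply: lee_sum => i /sD[_ /ltW].
  rewrite sum_cst_seq lte_fin sn.
  move: (ratr q) q0 => r r0.
  have kr : 0 < (k / r) `^ p by rewrite powR_gt0// divr_gt0.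
  have -> : K * n.+1%:R `^ a / r = K / k * n.+1%:R `^ a * (k / r).
    by field; rewrite !gt_eqF.
  rewrite powRM ?mulr_ge0 ?powR_ge0 ?invr_ge0 ?(ltW k0) ?(ltW r0)//.
  rewrite ltr_pM2r// powRM ?mulr_ge0 ?powR_ge0 ?invr_ge0 ?(ltW k0)//.
  rewrite -powRrM -ltr_pdivlMr ?powR_gt0//.
  by move: nM; rewrite powRB ?pnatr_eq0 ?implybT// powRr1.
- have h0 : 0 < 2^-1 - p^-1 by rewrite subr_gt0 ltf_pV2 ?posrE.
  have [n nM] := powR_unbounded (K / c) h0.
  have [s [sn us ds _]] := uncountable_pairwise n.+1 cI sym (fun i _ => nb i).
  have KN0 : 0 <= K * n.+1%:R `^ p^-1 by rewrite mulr_ge0// powR_ge0.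
  have : (weak_qnorm mu p (fun x => \sum_(i <- s) g i x)%R <=
      (K * n.+1%:R `^ p^-1)%:E)%E.
    apply/weak_qnorm_le => // l l0.
    rewrite (measure_norm_gt_sum mg (ltW l0) ds).
    apply: (@le_trans _ _ (\sum_(i <- s) ((K / l) `^ p)%:E)%E).
      by apply: lee_sum => i _; apply: (weak_qnorm_le mu (g i) p0 K0).1.
    rewrite sum_cst_seq lee_fin sn [in leRHS]mulrAC.
    by rewrite [in leRHS]powRM ?divr_ge0 ?powR_ge0 ?(ltW l0)// -powp// mulrC.
  move=> /(le_trans (L s us)); rewrite lee_fin sn; apply/negP; rewrite -ltNge.
  move: nM; rewrite powRB ?pnatr_eq0 ?implybT// ltr_pdivlMr ?powR_gt0//.
  by rewrite mulrAC ltr_pdivrMr// [ltRHS]mulrC.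
Qed.

(** * Atoms in purely atomic spaces *)

(** Call [X] good ([Q X]) if each of its non-null measurable subsets contains an atom. The
    measurable sets that are good or have a good complement form a sigma-algebra containing the
    atoms and null sets, hence are all the measurable sets. *)
Lemma purely_atomic_atom (R : realType) d (T : measurableType d)
    (mu : {measure set T -> \bar R}) (A : set T) :
  purely_atomic mu -> measurable A -> (0 < mu A)%E ->
  exists2 A', A' `<=` A & is_atom mu A'.
Proof.
move=> pa mA A0.
pose Q (X : set T) := forall B, measurable B -> B `<=` X -> (0 < mu B)%E ->
  exists2 A', A' `<=` B & is_atom mu A'.
pose G := [set X | measurable X /\ (Q X \/ Q (~` X))].
have QS (X Y : set T) : X `<=` Y -> Q Y -> Q X.
  by move=> XY QY B mB BX; apply: QY => //; exact: subset_trans XY.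
have QU (F : (set T)^nat) : (forall k, measurable (F k)) -> (forall k, Q (F k)) ->
    Q (\bigcup_k F k).
  move=> mF QF B mB BF B0; apply: contrapT => nB.
  move: B0; suff -> : mu B = 0%E by rewrite ltxx.
  have mBF k : measurable (B `&` F k) by exact: measurableI.
  apply/(negligibleP mu mB).
  apply: (@negligibleS _ _ _ _ (\bigcup_k (B `&` F k))).
    by move=> x Bx; have [k _ Fx] := BF _ Bx; exists k.
  apply: negligible_bigcup => k; apply/(negligibleP mu (mBF k)).
  apply/eqP; rewrite -measure_le0 leNgt; apply/negP => pos.
  have [A' A'B at'] := QF k _ (mBF k) (@subIsetr _ _ _) pos.
  by apply: nB; exists A' => // x /A'B[].
have mG : measurable `<=` G.
  rewrite pa; apply: smallest_sub; first split.
  - split; first exact: measurable0.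
    by left => B _ B0; move: B0; rewrite subset0 => ->; rewrite measure0 ltxx.
  - move=> X [mX QX]; rewrite /G setTD; split; first exact: measurableC.
    by rewrite setCK; case: QX; [right|left].
  (* One good complement makes the smaller complement of the union good; otherwise every [F k] is
     good, and so is the union. *)
  - move=> F GF; have mF k : measurable (F k) by case: (GF k).
    split; first exact: bigcupT_measurable.
    have [[k Qk]|h] := pselect (exists k, Q (~` F k)).
      by right; apply: QS Qk => x nF Fx; apply: nF; exists k.
    left; apply: QU => // k; have [_ [//|Qk]] := GF k.
    by exfalso; apply: h; exists k.
  - move=> X [atX|[mX X0]]; split => //.
    + by case: atX.
    (* A non-null measurable subset of an atom is itself an atom. *)
    + left => B mB BX B0; have [mX [_ hX]] := atX.
      exists B => //; split => //; split => // C mC CB.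
      have [C0|XC0] := hX C mC (subset_trans CB BX); [by left|right].
      apply/eqP; rewrite -measure_le0 -XC0; apply: le_measure; rewrite ?inE.
      * exact: measurableD.
      * exact: measurableD.
      * exact: setSD.
    + left => B mB BX; rewrite ltNge => /negP[]; rewrite -X0.
      by apply: le_measure; rewrite ?inE.
case: (mG _ mA) => _ [QA|QA].
  exact: QA.
have [atA|natA] := pselect (is_atom mu A); first by exists A.
(* A non-null set that is not an atom splits into two non-null parts. Either [B] or its complement
   is good, so one of the parts contains an atom. *)
have [B [mB BA B0 AB0]] : exists B, [/\ measurable B, B `<=` A, (0 < mu B)%E &
    (0 < mu (A `\` B))%E].
  apply: contrapT => h; apply: natA; split=> //; split=> // B mB BA.
  apply: contrapT => /not_orP[/eqP B0 /eqP AB0]; apply: h.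
  by exists B; split => //; rewrite lt0e ?B0 ?AB0 measure_ge0.
case: (mG _ mB) => _ [QB|QB].
  by have [A' A'B at'] := QB B mB (@subset_refl _ _) B0; exists A' => // x /A'B/BA.
have [A' A'B at'] := QB (A `\` B) (measurableD mA mB) (@subDsetr _ _ _) AB0.
by exists A' => // x /A'B[].
Qed.

(** * Weighted counting measures and the sequence space case *)

(* [measurableType] requires a base point. *)
Definition discrete_at (G : choiceType) (g0 : G) : Type := G.

HB.instance Definition _ (G : choiceType) (g0 : G) :=
  Choice.copy (discrete_at g0) G.

HB.instance Definition _ (G : choiceType) (g0 : G) :=
  isPointed.Build (discrete_at g0) g0.

HB.instance Definition _ (G : choiceType) (g0 : G) :=
  @isMeasurable.Build default_measure_display (discrete_at g0)
    discrete_measurable discrete_measurable0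
    discrete_measurableC discrete_measurableU.

(** The positivity proof is an argument so that the measure structure attached to this constant can
    use it. *)
Definition weighted_counting (R : realType) (G : choiceType) (g0 : G)
    (w : G -> R) (w0 : forall g, 0 < w g) : set (discrete_at g0) -> \bar R :=
  wmeasure w.

Arguments weighted_counting {R G} g0 {w} w0 _.

Lemma weighted_counting0 (R : realType) (G : choiceType) (g0 : G)
    (w : G -> R) (w0 : forall g, 0 < w g) :
  weighted_counting g0 w0 set0 = 0%E.
Proof. exact: esum_set0. Qed.

Arguments weighted_counting0 {R G} g0 {w} w0.

Lemma weighted_counting_ge0 (R : realType) (G : choiceType) (g0 : G)
    (w : G -> R) (w0 : forall g, 0 < w g) A :
  (0 <= weighted_counting g0 w0 A)%E.
Proof. by apply: esum_ge0 => g _; rewrite lee_fin ltW. Qed.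

Arguments weighted_counting_ge0 {R G} g0 {w} w0 A.

Lemma weighted_counting_sigma_additive (R : realType) (G : choiceType) (g0 : G)
    (w : G -> R) (w0 : forall g, 0 < w g) :
  semi_sigma_additive (weighted_counting g0 w0).
Proof.
move=> F _ tF _; rewrite /weighted_counting /wmeasure.
rewrite [X in _ --> X]esum_bigcup; last 2 first.
- exact: sub_trivIset tF.
- by move=> x _; rewrite lee_fin ltW.
rewrite -nneseries_esumT; last by move=> k; exact: weighted_counting_ge0.
by apply: is_cvg_nneseries => k _ _; exact: weighted_counting_ge0.
Qed.

HB.instance Definition _ (R : realType) (G : choiceType) (g0 : G)
    (w : G -> R) (w0 : forall g, 0 < w g) :=
  isMeasure.Build _ _ _ (weighted_counting g0 w0) (weighted_counting0 g0 w0)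
    (weighted_counting_ge0 g0 w0) (@weighted_counting_sigma_additive R G g0 w w0).

Lemma weighted_counting_atom (R : realType) (G : choiceType) (g0 : G)
    (w : G -> R) (w0 : forall g, 0 < w g) (A : set (discrete_at g0)) :
  measurable A -> (0 < weighted_counting g0 w0 A)%E ->
  exists2 A', A' `<=` A & is_atom (weighted_counting g0 w0) A'.
Proof.
move=> _ A0; have [g Ag] : A !=set0.
  by apply/set0P/eqP => e; move: A0; rewrite e weighted_counting0 ltxx.
exists [set g]; first by move=> _ ->.
split => //; split; first by rewrite /weighted_counting /wmeasure esum_set1 ?lte_fin ?lee_fin// ltW.
move=> B _ Bg; have [gB|gB] := pselect (B g).
- right; rewrite (_ : _ `\` _ = set0) ?weighted_counting0//.
  by apply/seteqP; split => // x [-> /(_ gB)].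
- left; rewrite (_ : B = set0) ?weighted_counting0//.
  by apply/seteqP; split => // x Bx; apply: gB; rewrite -(Bg _ Bx).
Qed.

Lemma l2norm_indicator (R : realType) (I : choiceType) (s : seq I) :
  uniq s ->
  l2norm (fun j => \sum_(i <- s) (j == i)%:R : R) = ((size s)%:R `^ 2^-1)%:E.
Proof.
move=> us; rewrite /l2norm -poweR_EFin; congr (poweR _ _).
have e j : \sum_(i <- s) (j == i)%:R = (j \in s)%:R :> R.
  have [js|js] := boolP (j \in s).
    rewrite (bigD1_seq j)//= eqxx big1 ?addr0// => i; rewrite eq_sym.
    by move=> /negPf ->.
  by rewrite big_seq big1// => i iS; case: eqP => // ji; rewrite ji iS in js.
rewrite (eq_esum (b := fun j => if j \in [set` s] then 1%:E else 0%E)); last first.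
  move=> j _; rewrite e; case: ifPn; rewrite ?in_setE ?notin_setE /= => js.
    by rewrite js expr1n.
  by rewrite (negPf (introN idP js)) expr0n.
rewrite -esum_mkcond esum_fset; [|exact: finite_seq|by move=> j _; exact: lee01].
by rewrite -fsbig_seq// sum_cst_seq mulr1.
Qed.

Lemma no_l2_in_weighted_lp (R : realType) (I G : choiceType) (p : R) (w : G -> R) :
  ~ countable [set: I] -> 1 < p -> p != 2 -> (forall g, 0 < w g) ->
  ~ exists (T : (I -> R) -> (G -> R)) (c C : R),
      0 < c /\
      (forall x, (l2norm x < +oo)%E ->
         (weak_qnorm (wmeasure w) p (T x) < +oo)%E /\
         (c%:E * l2norm x <= weak_qnorm (wmeasure w) p (T x))%E /\
         (weak_qnorm (wmeasure w) p (T x) <= C%:E * l2norm x)%E) /\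
      (forall (a : R) x y, (l2norm x < +oo)%E -> (l2norm y < +oo)%E ->
         T (fun i => a * x i + y i) = (fun g => a * T x g + T y g)).
Proof.
move=> cI p1 p2 w0 [T [c [C [c0 [Tb Tl]]]]]; have p0 : 0 < p by lra.
pose e i : I -> R := fun j => (j == i)%:R.
have fin (s : seq I) : uniq s ->
    (l2norm (fun j => \sum_(i <- s) e i j)%R < +oo)%E.
  by move=> us; rewrite l2norm_indicator// ltry.
have Ts (s : seq I) : uniq s ->
    T (fun j => \sum_(i <- s) e i j) = (fun g => \sum_(i <- s) T (e i) g).
  elim: s => [_|i s IH /= /andP[iS us]].
    (* Linearity at zero reads [T 0 = T 0 + T 0], so [T 0] vanishes. *)
    have := Tl 1 _ _ (fin [::] isT) (fin [::] isT).
    rewrite (_ : (fun i => 1 * _ + _) = (fun j => \sum_(i <- [::]) e i j)).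
      move=> /(congr1 (fun f => f _)) h; apply/funext => g; rewrite big_nil.
      by have := h g; rewrite mul1r; lra.
    by apply/funext => j; rewrite big_nil mulr0 addr0.
  have := Tl 1 (e i) _ _ (fin s us).
  rewrite IH// (_ : (fun i => 1 * _ + _) = (fun j => \sum_(i <- i :: s) e i j)).
    move=> ->; first by apply/funext => g; rewrite big_cons mul1r.
    have := fin [:: i] isT; congr (l2norm _ < _)%E.
    by apply/funext => j; rewrite big_seq1.
  by apply/funext => j; rewrite big_cons mul1r.
(* A base point is required. If [G] were empty, a unit vector and zero would have the same image,
   against the lower bound. *)
have [g0] : exists g0 : G, True.
  apply: contrapT => nG; have [i _] : exists i : I, True.
    apply: contrapT => nI; apply: cI.
    rewrite (_ : [set: I] = set0); first exact: countable0.
    by apply/seteqP; split => // i _; case: nI; exists i.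
  have T0 : T (fun j => \sum_(i <- [:: i]) e i j) = T (fun j => \sum_(i <- [::]) e i j).
    by apply/funext => g; case: nG; exists g.
  have := Tb _ (fin [:: i] isT); rewrite T0 => -[_ [+ _]].
  move=> /le_trans /(_ (Tb _ (fin [::] isT)).2.2).
  rewrite !l2norm_indicator// powR1 powR0 ?invr_eq0 ?pnatr_eq0// mule1 mule0.
  by rewrite lee_fin leNgt c0.
move=> _.
apply: (@no_l2_system R _ _ (weighted_counting g0 w0) I (fun i => T (e i)) p c
  `|C| 2^-1 (@weighted_counting_atom R G g0 w w0)) => //.
- by rewrite invf_lt1// ltr1n.
- by move=> p2'; rewrite mulrC ltr_pdivrMr// mul1r.
- move=> s us; rewrite -Ts//; apply: le_trans (Tb _ (fin s us)).2.2 _.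
  rewrite l2norm_indicator// -EFinM lee_fin ler_wpM2r ?powR_ge0//.
  exact: ler_norm.
- move=> s us; rewrite -Ts//; apply: le_trans (Tb _ (fin s us)).2.1.
  by rewrite l2norm_indicator.
Qed.

(** * Moments and tails of the simple random walk *)

(* The mean of [phi] at the position after [n] steps of the simple random walk started at [x]. *)
Fixpoint walk_mean (R : realType) (n : nat) (phi : R -> R) (x : R) : R :=
  if n is m.+1 then (walk_mean m phi (x + 1) + walk_mean m phi (x - 1)) / 2
  else phi x.

Lemma walk_mean_le (R : realType) n (phi psi : R -> R) (x : R) :
  (forall y, phi y <= psi y) -> walk_mean n phi x <= walk_mean n psi x.
Proof.
move=> h; elim: n x => [|n IH] x //=.
by rewrite ler_pM2r// lerD.
Qed.

(** The second and fourth moments of the walk; both tail estimates compare an indicator with such a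
    polynomial. *)
Lemma walk_mean_quartic (R : realType) n (a b c x : R) :
  walk_mean n (fun y => a * y ^+ 4 + b * y ^+ 2 + c) x =
  a * (x ^+ 4 + 6 * n%:R * x ^+ 2 + 3 * n%:R ^+ 2 - 2 * n%:R) +
  b * (x ^+ 2 + n%:R) + c.
Proof.
elim: n x => [|n IH] x /=; first by ring.
by rewrite !IH -[n.+1%:R]natr1; field.
Qed.

Lemma walk_chebyshev (R : realType) n (c : R) : 0 < c ->
  walk_mean n (fun y => (c < `|y|)%R%:R) 0 <= n%:R / c ^+ 2.
Proof.
move=> c0.
have -> : n%:R / c ^+ 2 =
    walk_mean n (fun y => 0 * y ^+ 4 + (c ^+ 2)^-1 * y ^+ 2 + 0) 0.
  by rewrite walk_mean_quartic; field; rewrite gt_eqF.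
apply: walk_mean_le => y; rewrite mul0r add0r addr0 mulrC.
case: ltP => h /=; last by rewrite divr_ge0 ?sqr_ge0.
rewrite ler_pdivlMr ?exprn_gt0// mul1r -[leRHS]real_normK ?num_real//.
by rewrite lerXn2r ?nnegrE ?(ltW c0) ?(ltW h).
Qed.

(* Paley-Zygmund through an explicit minorant: for [t = y ^+ 2 / n] the indicator of [t > 1/4] is at least [(t - 1/4) (5 - t) / 6]. *)
Lemma walk_anticoncentration (R : realType) n : (0 < n)%N ->
  6^-1 <= walk_mean n (fun y : R => (n%:R `^ 2^-1 / 2 < `|y|)%R%:R) 0.
Proof.
move=> n0; have N0 : 0 < n%:R :> R by rewrite ltr0n.
pose N : R := n%:R; rewrite -/N in N0 *.
(* The coefficients of the minorant expanded in powers of [y]; its mean comes out as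
   [6^-1 + (3 * N)^-1]. *)
pose a : R := - (6 * N ^+ 2)^-1; pose b : R := 21 / 24 / N.
apply: (@le_trans _ _ (walk_mean n (fun y => a * y ^+ 4 + b * y ^+ 2 + - (5 / 24)) 0)).
  rewrite walk_mean_quartic -/N.
  have -> : a * (0 ^+ 4 + 6 * N * 0 ^+ 2 + 3 * N ^+ 2 - 2 * N) +
      b * (0 ^+ 2 + N) - 5 / 24 = 6^-1 + (3 * N)^-1.
    by rewrite /a /b; field; rewrite gt_eqF.
  by rewrite lerDl invr_ge0 mulr_ge0// ltW.
apply: walk_mean_le => y; set t := y ^+ 2 / N.
have -> : a * y ^+ 4 + b * y ^+ 2 - 5 / 24 = (t - 4^-1) * (5 - t) / 6.
  by rewrite /t /a /b; field; rewrite gt_eqF.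
have t0 : 0 <= t by rewrite divr_ge0 ?sqr_ge0// ltW.
case: ltP => /= h.
  (* The minorant peaks at [t = 21 / 8] with value [361 / 384], below [1]. *)
  have : 0 <= (t - 21 / 8) ^+ 2 by exact: sqr_ge0.
  by rewrite expr2 => ?; lra.
have ty : t <= 4^-1.
  rewrite /t ler_pdivrMr// -(real_normK (num_real y)).
  have : `|y| ^+ 2 <= (N `^ 2^-1 / 2) ^+ 2.
    by rewrite lerXn2r ?nnegrE// divr_ge0 ?powR_ge0.
  rewrite expr_div_n -[X in X / _]powR_mulrn ?powR_ge0// -powRrM mulVf//.
  by rewrite powRr1 ?(ltW N0)// => H; lra.
have : 0 <= (4^-1 - t) * (5 - t) by rewrite mulr_ge0//; lra.
by move=> ?; lra.
Qed.

(** * Rademacher sums in the weak quasi-norm *)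

Definition rademacher (R : realType) (I : Type) (i : I) (f : cube I) : R :=
  if f i then 1 else -1.

Lemma In_mem (I : eqType) (i : I) (s : seq I) : In i s <-> i \in s.
Proof.
elim: s => //= j s IH; rewrite inE; split.
  by move=> [->|/IH ->]; rewrite ?eqxx ?orbT.
by move=> /predU1P[->|/IH]; [left|right].
Qed.

Lemma uniq_NoDup (I : eqType) (s : seq I) : uniq s -> NoDup s.
Proof.
elim: s => [_|i s IH /= /andP[iS us]]; first exact: NoDup_nil.
by apply: NoDup_cons; [move=> /In_mem; apply/negP|exact: IH].
Qed.

Lemma measurable_coord (I : Type) (i : I) (b : bool) :
  measurable ([set f | f i = b] : set (cube I)).
Proof. by apply: sub_sigma_algebra; exists i, b. Qed.

Lemma measurable_rademacher (R : realType) (I : Type) (i : I) :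
  measurable_fun setT (rademacher R i).
Proof.
apply: measurable_fun_ifT => //.
apply: (measurable_fun_bool true).
by rewrite setTI; exact: measurable_coord.
Qed.

(** The coordinates in [s] are already revealed with signs [e]. Revealing the next one splits the
    event into two disjoint events, with the start moved by [1] or [-1], which is the recursion of
    [walk_mean]; once [t] is exhausted a cylinder or the empty set remains. *)
Lemma rademacher_sum_walk (R : realType) (I : choiceType)
    (nu : {measure set (cube I) -> \bar R}) (P : pred R) (t s : seq I)
    (e : I -> bool) (x : R) :
  is_coin_product nu -> uniq (s ++ t) ->
  let A := [set f : cube I | (forall i, i \in s -> f i = e i) /\
                             P (x + \sum_(i <- t) rademacher R i f)] in
  measurable A /\
  nu A = (2 ^- size s * walk_mean (size t) (fun y => (P y)%:R) x)%:E.
Proof.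
move=> hnu; elim: t s e x => [|i t IH] s e x.
  rewrite cats0 => us A.
  pose Z := [set f : cube I | forall i, i \in s -> f i = e i].
  have nuZ : nu Z = (2 ^- size s)%:E.
    rewrite -[size s]/(length s) -(hnu s e (uniq_NoDup us)); congr (nu _).
    by apply/seteqP; split => f h i /In_mem; exact: h.
  have mZ : measurable Z.
    rewrite (_ : Z = \big[setI/setT]_(i <- s) [set f : cube I | f i = e i]).
      by apply: bigsetI_measurable => j _; exact: measurable_coord.
    rewrite -bigcap_seq; apply/seteqP; split => f h j; exact: h.
  have [Px|Px] := boolP (P x).
    have -> : A = Z.
      apply/seteqP; split => f; first by move=> [].
      by move=> h; split => //; rewrite big_nil addr0.
    by rewrite /= Px mulr1.
  have -> : A = set0.
    apply/seteqP; split => // f [_]; rewrite big_nil addr0 => Px'.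
    by rewrite Px' in Px.
  by rewrite /= (negPf Px) mulr0 measure0; split.
move=> us A.
have us' : uniq ((i :: s) ++ t) by move: us; rewrite -cat1s uniq_catCA.
have iS : i \notin s by move: us'; rewrite /= mem_cat negb_or => /andP[/andP[]].
pose e' b j := if j == i then b else e j.
have [m1 n1] := IH (i :: s) (e' true) (x + 1) us'.
have [m2 n2] := IH (i :: s) (e' false) (x - 1) us'.
set A1 := [set f | _] in m1 n1; set A2 := [set f | _] in m2 n2.
have A12 : A = A1 `|` A2.
  have ee b f : (forall j, j \in i :: s -> f j = e' b j) <->
      f i = b /\ (forall j, j \in s -> f j = e j).
    rewrite /e'; split.
      move=> h; split; first by rewrite h ?mem_head// eqxx.
      move=> j js; rewrite h ?inE ?js ?orbT//.
      by case: eqP => // ji; rewrite -ji js in iS.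
    move=> [fi h] j; rewrite inE; case: eqP => [->//|_] /=; exact: h.
  apply/seteqP; split => f.
    move=> [h]; rewrite big_cons addrA /rademacher.
    by case fi: (f i) => h'; [left|right]; split => //; apply/ee.
  by move=> [[/ee[fi h] h']|[/ee[fi h] h']]; split => //;
    move: h'; rewrite big_cons addrA {2}/rademacher fi.
split; first by rewrite A12; exact: measurableU.
have A12_0 : A1 `&` A2 = set0.
  apply/seteqP; split => // f [[h1 _] [h2 _]].
  by have := h1 i (mem_head _ _); rewrite (h2 i (mem_head _ _)) /e' eqxx.
have -> : nu A = (nu A1 + nu A2)%E by rewrite A12 measureU.
rewrite n1 n2 -EFinD /= exprS; congr EFin; field.
by rewrite expf_neq0.
Qed.

Lemma weak_qnorm_ge0 (R : realType) (T : Type) (mu : set T -> \bar R) (p : R)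
    (f : T -> R) :
  (0 <= weak_qnorm mu p f)%E.
Proof.
apply: (@le_trans _ _ (1%:E * poweR (mu [set x | (1 < `|f x|)%R]) p^-1)%E).
  by rewrite mul1e poweR_ge0.
by apply: ereal_sup_ubound; exists 1 => //=.
Qed.

Lemma measurable_rademacher_sum (R : realType) (I : Type) (s : seq I) :
  measurable_fun setT (fun f => \sum_(i <- s) rademacher R i f).
Proof. by apply: measurable_sum => i; exact: measurable_rademacher. Qed.

Lemma rademacher_sum_tail (R : realType) (I : choiceType)
    (nu : {measure set (cube I) -> \bar R}) (s : seq I) (c : R) :
  is_coin_product nu -> uniq s ->
  nu [set f | c < `|\sum_(i <- s) rademacher R i f|] =
  (walk_mean (size s) (fun y => (c < `|y|)%R%:R) 0)%:E.
Proof.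
move=> hnu us.
have [_ h] := rademacher_sum_walk (fun y => c < `|y|) (fun=> true) 0 hnu
  (us : uniq ([::] ++ s)).
rewrite -[RHS]mul1e -[1%E]/(1%:E) -EFinM -[X in X * walk_mean _ _ _]invr1 -h.
by congr (nu _); apply/seteqP; split => f /=; rewrite add0r; [split|case].
Qed.

Lemma rademacher_sum_bound (R : realType) (I : Type) (s : seq I) (f : cube I) :
  `|\sum_(i <- s) rademacher R i f| <= (size s)%:R.
Proof.
apply: le_trans (ler_norm_sum _ _ _) _.
rewrite -[leRHS]mulr1 mulr_natl -iter_addr_0 -count_predT -big_const_seq.
by apply: ler_sum => i _; rewrite /rademacher; case: (f i); rewrite ?normrN normr1.
Qed.

(* [1 - p^-1] is far from the true exponent [2^-1] when [2 < p], but any exponent below [1] is enough. *)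
Lemma rademacher_sum_weak_qnorm_le (R : realType) (I : choiceType)
    (nu : {measure set (cube I) -> \bar R}) (p : R) (s : seq I) :
  is_coin_product nu -> uniq s -> 1 < p ->
  (weak_qnorm nu p (fun f => \sum_(i <- s) rademacher R i f)%R <=
   ((size s)%:R `^ (if p < 2 then 2^-1 else 1 - p^-1))%:E)%E.
Proof.
move=> hnu us p1; have p0 : 0 < p by lra.
apply/weak_qnorm_le => // c c0.
(* At levels from [size s] on the level set is empty; below, [1 < N / c]. *)
have [nc|cn] := leP (size s)%:R c.
  rewrite (_ : [set _ | _] = set0) ?measure0 ?lee_fin ?powR_ge0//.
  apply/seteqP; split => // f /= h.
  by have := lt_le_trans (le_lt_trans nc h) (rademacher_sum_bound R s f);
    rewrite ltxx.
have n0 : 0 < (size s)%:R :> R by exact: lt_trans cn.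
rewrite rademacher_sum_tail// lee_fin.
have cheb := walk_chebyshev (size s) c0; set m := walk_mean _ _ _ in cheb *.
have m1 : m <= 1.
  apply: le_trans (walk_mean_le (psi := fun y => 0 * y ^+ 4 + 0 * y ^+ 2 + 1) _ _ _) _.
    by move=> y; rewrite !mul0r !add0r; case: ltP => _; rewrite ?ler01.
  by rewrite walk_mean_quartic !mul0r !add0r.
move: (size s)%:R n0 cn cheb => N N0 cn cheb.
case: ifPn => p2.
  (* The tail is at most both [1] and [u]^ 2[, and the smaller of these is at most]u [^ p] because
     [p < 2]. *)
  set u := N `^ 2^-1 / c; have u0 : 0 < u by rewrite divr_gt0// powR_gt0.
  have uE : N / c ^+ 2 = u `^ 2.
    rewrite -[2]/(2%:R) powR_mulrn ?(ltW u0)// /u expr_div_n; congr (_ / _).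
    by rewrite -powR_mulrn ?powR_ge0// -powRrM mulVf// powRr1 ?(ltW N0).
  have [u1|u1] := leP 1 u.
    by apply: (le_trans m1); rewrite -[leLHS](powRr0 u) ler_powR// ltW.
  apply: (le_trans cheb); rewrite uE; apply: ger_powR; last exact: ltW.
  by rewrite u0 ltW.
rewrite -leNgt in p2; apply: (le_trans cheb).
(* The target equals [(N / c)]^ p / N[and the Chebyshev bound](N / c) [^ 2 / N], so [1 < N / c] and
   [2 <= p] conclude. *)
have -> : N `^ (1 - p^-1) / c = N / c * N `^ (- p^-1).
  by rewrite powRD ?(gt_eqF N0) ?implybT// powRr1 ?(ltW N0)// mulrAC.
rewrite powRM ?powR_ge0 ?divr_ge0 ?(ltW c0) ?(ltW N0)//.
rewrite -powRrM mulNr mulVf ?gt_eqF// powR_inv1 ?(ltW N0)//.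
rewrite ler_pdivlMr// (_ : N / c ^+ 2 * N = (N / c) `^ 2).
  by apply: ler_powR => //; rewrite ler_pdivlMr// mul1r ltW.
rewrite -[2]/(2%:R) powR_mulrn ?divr_ge0 ?(ltW c0) ?(ltW N0)//.
by rewrite expr_div_n mulrAC -expr2.
Qed.

Lemma rademacher_sum_weak_qnorm_ge (R : realType) (I : choiceType)
    (nu : {measure set (cube I) -> \bar R}) (p : R) (s : seq I) :
  is_coin_product nu -> uniq s -> 0 < p ->
  ((6^-1 `^ p^-1 / 2 * (size s)%:R `^ 2^-1)%:E <=
   weak_qnorm nu p (fun f => \sum_(i <- s) rademacher R i f)%R)%E.
Proof.
move=> hnu us p0; have [s0|s0] := posnP (size s).
  rewrite s0 powR0 ?invr_eq0 ?pnatr_eq0// mulr0.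
  exact: weak_qnorm_ge0.
(* One level suffices: half the standard deviation, exceeded with probability at least [6^-1]. *)
pose c := (size s)%:R `^ 2^-1 / 2 : R.
have c0 : 0 < c by rewrite divr_gt0// powR_gt0// ltr0n.
apply: (@le_trans _ _ (c%:E * poweR (nu [set f | (c < `|\sum_(i <- s)
    rademacher R i f|)%R]) p^-1)%E); last by apply: ereal_sup_ubound; exists c.
rewrite rademacher_sum_tail// poweR_EFin -EFinM lee_fin.
rewrite mulrAC -mulrA mulrC ler_wpM2l ?(ltW c0)//.
have h := walk_anticoncentration R s0.
by apply: ge0_ler_powR; rewrite ?nnegrE ?invr_ge0 ?(ltW p0)//; apply: le_trans h.
Qed.

(** * Embeddings of the weak space over the cube *)

Lemma ae_weak_qnorm (R : realType) d (T : measurableType d)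
    (mu : {measure set T -> \bar R}) (p : R) (f g : T -> R) :
  measurable_fun setT f -> measurable_fun setT g ->
  {ae mu, forall x, f x = g x} -> weak_qnorm mu p f = weak_qnorm mu p g.
Proof.
move=> mf mg [N [mN N0 fgN]]; rewrite /weak_qnorm; congr ereal_sup.
apply: eq_imagel => c _; congr (_ * poweR _ _)%E.
apply: (measure_eq_off_null _ _ mN N0); try exact: measurable_norm_gt.
apply/seteqP; split => x [/= h|]; try by right.
- have [fg|fg] := eqVneq (f x) (g x); first by left; rewrite /= -fg.
  by right; apply: fgN => /= e; rewrite e eqxx in fg.
- have [fg|fg] := eqVneq (f x) (g x); first by left; rewrite /= fg.
  by right; apply: fgN => /= e; rewrite e eqxx in fg.
Qed.

(** The Rademacher functions replace the unit vectors. [T] is linear only almost everywhere, which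
    is enough since each sum is finite and the quasi-norm ignores null sets. *)
Lemma no_cube_in_atomic (R : realType) (I : choiceType) (p : R)
    (nu : {measure set (cube I) -> \bar R})
    (d : measure_display) (Om : measurableType d)
    (mu : {measure set Om -> \bar R}) :
  ~ countable [set: I] -> 1 < p -> p != 2 ->
  is_coin_product nu -> purely_atomic mu ->
  ~ exists (T : (cube I -> R) -> (Om -> R)) (c C : R),
      0 < c /\
      (forall f, in_weakLp nu p f ->
         in_weakLp mu p (T f) /\
         (c%:E * weak_qnorm nu p f <= weak_qnorm mu p (T f))%E /\
         (weak_qnorm mu p (T f) <= C%:E * weak_qnorm nu p f)%E) /\
      (forall (a : R) f g, in_weakLp nu p f -> in_weakLp nu p g ->
         {ae mu, forall x, T (fun t => a * f t + g t) x = a * T f x + T g x}).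
Proof.
move=> cI p1 p2 hnu pa [T [c [C [c0 [Tb Tl]]]]]; have p0 : 0 < p by lra.
pose r := @rademacher R I.
pose S s f := \sum_(i <- s) r i f.
have Sin s : uniq s -> in_weakLp nu p (S s).
  move=> us; split; first exact: measurable_rademacher_sum.
  by apply: le_lt_trans (rademacher_sum_weak_qnorm_le hnu us p1) _; rewrite ltry.
have S1 i : S [:: i] = r i by apply/funext => f; rewrite /S big_seq1.
have rin i : in_weakLp nu p (r i) by rewrite -S1; exact: Sin.
have mT i : measurable_fun setT (T (r i)) by have [[]] := Tb _ (rin i).
have TS s : uniq s -> {ae mu, forall x, T (S s) x = \sum_(i <- s) T (r i) x}.
  elim: s => [_|i s IH /= /andP[_ us]].
    have := Tl 1 _ _ (Sin [::] isT) (Sin [::] isT).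
    rewrite (_ : (fun t => 1 * S [::] t + S [::] t) = S [::]); last first.
      by apply/funext => f; rewrite /S big_nil mulr0 addr0.
    by apply: filterS => x h; rewrite big_nil; lra.
  have := Tl 1 _ _ (rin i) (Sin s us).
  rewrite (_ : (fun t => 1 * r i t + S s t) = S (i :: s)); last first.
    by apply/funext => f; rewrite /S big_cons mul1r.
  by move: (IH us); apply: filterS2 => x h1 ->; rewrite h1 big_cons mul1r.
have Tq s : uniq s -> weak_qnorm mu p (fun x => \sum_(i <- s) T (r i) x) =
    weak_qnorm mu p (T (S s)).
  move=> us; apply/esym/ae_weak_qnorm; last exact: TS.
  - by have [[]] := Tb _ (Sin s us).
  - exact: measurable_sum.
apply: (@no_l2_system R _ _ mu I (fun i => T (r i)) p (c * (6^-1 `^ p^-1 / 2))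
  `|C| (if p < 2 then 2^-1 else 1 - p^-1)) => //.
- by move=> A mA A0; exact: purely_atomic_atom.
- by rewrite mulr_gt0// divr_gt0// powR_gt0.
- by case: ifP => _; [rewrite invf_lt1// ltr1n|rewrite gtrBl invr_gt0].
- by move=> p2'; rewrite p2' mulrC ltr_pdivrMr// mul1r.
- move=> s us; rewrite Tq//; apply: le_trans (Tb _ (Sin s us)).2.2 _.
  apply: (@le_trans _ _ (`|C|%:E * weak_qnorm nu p (S s))%E).
    by apply: lee_wpmul2r; [exact: weak_qnorm_ge0|rewrite lee_fin ler_norm].
  rewrite EFinM lee_wpmul2l ?lee_fin//; exact: rademacher_sum_weak_qnorm_le.
- move=> s us; rewrite Tq//; apply: le_trans (Tb _ (Sin s us)).2.1.
  rewrite -mulrA EFinM lee_wpmul2l ?lee_fin ?(ltW c0)//.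
  exact: rademacher_sum_weak_qnorm_ge.
Qed.

Theorem theorem7 (R : realType) (I : choiceType) (p : R) :
  ~ countable [set: I] -> 1 < p -> p != 2 ->
  (* (1) ell^{p,infty}(Gamma, w) contains no subspace isomorphic to ell^2(I) *)
  (forall (G : choiceType) (w : G -> R), (forall g, 0 < w g) ->
    ~ exists (T : (I -> R) -> (G -> R)) (c C : R),
        0 < c /\
        (forall x, (l2norm x < +oo)%E ->
           (weak_qnorm (wmeasure w) p (T x) < +oo)%E /\
           (c%:E * l2norm x <= weak_qnorm (wmeasure w) p (T x))%E /\
           (weak_qnorm (wmeasure w) p (T x) <= C%:E * l2norm x)%E) /\
        (forall (a : R) x y, (l2norm x < +oo)%E -> (l2norm y < +oo)%E ->
           T (fun i => a * x i + y i) = (fun g => a * T x g + T y g))) /\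
  (* (2) L^{p,infty}({-1,1}^I) does not embed isomorphically into
         L^{p,infty}(Omega, Sigma, mu) for purely atomic mu *)
  (forall (nu : {measure set (cube I) -> \bar R}), is_coin_product nu ->
   forall (d : measure_display) (Om : measurableType d)
          (mu : {measure set Om -> \bar R}),
     has_finite_pos_set mu -> purely_atomic mu ->
     ~ exists (T : (cube I -> R) -> (Om -> R)) (c C : R),
         0 < c /\
         (forall f, in_weakLp nu p f ->
            in_weakLp mu p (T f) /\
            (c%:E * weak_qnorm nu p f <= weak_qnorm mu p (T f))%E /\
            (weak_qnorm mu p (T f) <= C%:E * weak_qnorm nu p f)%E) /\
         (forall (a : R) f g, in_weakLp nu p f -> in_weakLp nu p g ->
            {ae mu, forall x, T (fun t => a * f t + g t) x = a * T f x + T g x})).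
Proof.
move=> cI p1 p2; split; first by move=> G w w0; exact: no_l2_in_weighted_lp.
by move=> nu hnu d Om mu _ pa; exact: no_cube_in_atomic.
Qed.
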